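(* Let $G$ be a connected twin-free line graph of order at least $4$, and let $H$ be a connected graph with $L(H)=G$ (up to isomorphism). Then $G\in \mathrm{ORTH}[3,2,2]$ if and only if all blocks of $H$ have order at most $3$.
   Context: Graphs are finite and simple. $L(H)$ is the line graph of $H$. A block of a graph is a maximal connected subgraph without a cut vertex. Two distinct vertices $u,v$ are twins if $N[u]=N[v]$; a graph is twin-free if it has no twins. For positive integers $h,s,t$, $\mathrm{ORTH}[h,s,t]$ is the class of graphs $G$ having a pair $(T,\mathcal{S})$, where $T$ is a tree of maximum degree at most $h$ and $\mathcal{S}=(S_u)_{u\in V(G)}$ is a collection of subtrees of $T$ of maximum degree at most $s$, one per vertex of $G$, such that every leaf of each $S_u$ is a leaf of $T$, and for all distinct $u,v\in V(G)$ the following are equivalent: (i) $u,v$ adjacent; (ii) $S_u,S_v$ have at least $t$ common vertices; (iii) $S_u,S_v$ share a leaf of $T$. *)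

(* Defs.v *)
From mathcomp Require Import all_boot.

Set Implicit Arguments.
Unset Strict Implicit.
Unset Printing Implicit Defensive.

Record sgraph := SGraph {
  vertex :> finType;
  edge : rel vertex;
  edge_sym : symmetric edge;
  edge_irrefl : irreflexive edge }.

(* Subgraphs need not be induced. *)
Record subgraph (G : sgraph) := Subgraph {
  sverts : {set G};
  sedge : rel G;
  sedge_sym : symmetric sedge;
  sedge_sub : forall x y : G,
    sedge x y -> [&& edge x y, x \in sverts & y \in sverts] }.

Definition subgraph_le (G : sgraph) (K K' : subgraph G) : Prop :=
  sverts K \subset sverts K' /\ subrel (sedge K) (sedge K').

Lemma whole_sub (G : sgraph) (x y : G) :
  edge x y -> [&& edge x y, x \in [set: G] & y \in [set: G]].
Proof. by rewrite !inE !andbT. Qed.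

Definition whole (G : sgraph) : subgraph G :=
  Subgraph (@edge_sym G) (@whole_sub G).

Section DeleteVertex.
Variables (G : sgraph) (K : subgraph G) (v : G).

Definition delete_edge : rel G :=
  [rel x y | [&& sedge K x y, x != v & y != v]].

Lemma delete_edge_sym : symmetric delete_edge.
Proof. by move=> x y; rewrite /delete_edge /= sedge_sym [(x != v) && _]andbC. Qed.

Lemma delete_edge_sub (x y : G) : delete_edge x y ->
  [&& edge x y, x \in sverts K :\ v & y \in sverts K :\ v].
Proof.
by case/and3P=> /(sedge_sub (s := K))/and3P[-> xK yK] xv yv; rewrite !inE xv yv xK.
Qed.

Definition delete_vertex : subgraph G := Subgraph delete_edge_sym delete_edge_sub.

End DeleteVertex.

Definition connected (G : sgraph) (K : subgraph G) : Prop :=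
  sverts K != set0 /\
  {in sverts K &, forall x y, connect (sedge K) x y}.

(* Deleting [v] separates two vertices of the component of [v], that is,
   increases the number of components of [K]. *)
Definition cut_vertex (G : sgraph) (K : subgraph G) (v : G) : Prop :=
  v \in sverts K /\
  exists x y : G,
    [/\ x \in sverts (delete_vertex K v), y \in sverts (delete_vertex K v),
        connect (sedge K) x y
      & ~~ connect (sedge (delete_vertex K v)) x y].

Definition nonseparable (G : sgraph) (K : subgraph G) : Prop :=
  connected K /\ forall v : G, ~ cut_vertex K v.

Definition block (G : sgraph) (K : subgraph G) : Prop :=
  nonseparable K /\
  forall K' : subgraph G,
    nonseparable K' -> subgraph_le K K' -> subgraph_le K' K.

Definition acyclic (G : sgraph) (K : subgraph G) : Prop :=
  forall c : seq G, ucycle (sedge K) c -> size c < 3.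

Definition is_tree (G : sgraph) (K : subgraph G) : Prop :=
  connected K /\ acyclic K.

Definition degree (G : sgraph) (K : subgraph G) (x : G) : nat :=
  #|[set y | sedge K x y]|.

Definition max_degree_le (G : sgraph) (K : subgraph G) (d : nat) : Prop :=
  {in sverts K, forall x, degree K x <= d}.

(* A one-vertex tree has no leaf. *)
Definition leaf (G : sgraph) (K : subgraph G) (x : G) : Prop :=
  x \in sverts K /\ degree K x = 1.

Definition closed_nbhd (G : sgraph) (u : G) : {set G} :=
  u |: [set w | edge u w].

Definition twins (G : sgraph) (u v : G) : Prop :=
  u <> v /\ closed_nbhd u = closed_nbhd v.

Definition twin_free (G : sgraph) : Prop := forall u v : G, ~ twins u v.

Definition isomorphic (G G' : sgraph) : Prop :=
  exists2 f : G -> G', bijective f & {mono f : x y / edge x y}.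

Definition edge_set (H : sgraph) : {set {set H}} :=
  [set [set p.1; p.2] | p : H * H & edge p.1 p.2].

Section LineGraph.
Variable H : sgraph.

Definition line_vertex : finType := {A : {set H} | A \in edge_set H}.

Definition line_edge : rel line_vertex :=
  [rel A B | (A != B) && (val A :&: val B != set0)].

Lemma line_edge_sym : symmetric line_edge.
Proof. by move=> A B; rewrite /line_edge /= eq_sym setIC. Qed.

Lemma line_edge_irrefl : irreflexive line_edge.
Proof. by move=> A; rewrite /line_edge /= eqxx. Qed.

Definition line_graph : sgraph := SGraph line_edge_sym line_edge_irrefl.

End LineGraph.

Definition orth_representation (h s t : nat) (G T : sgraph)
    (S : G -> subgraph T) : Prop :=
  [/\ is_tree (whole T) /\ max_degree_le (whole T) h,
      forall u : G, is_tree (S u) /\ max_degree_le (S u) s,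
      forall (u : G) (x : T), leaf (S u) x -> leaf (whole T) x
    & forall u v : G, u <> v ->
        (edge u v <-> t <= #|sverts (S u) :&: sverts (S v)|) /\
        (edge u v <->
         exists x : T, [/\ leaf (whole T) x, x \in sverts (S u)
                         & x \in sverts (S v)])].

Definition ORTH (h s t : nat) (G : sgraph) : Prop :=
  exists (T : sgraph) (S : G -> subgraph T), orth_representation h s t S.

(* Main.v *)
Require Import Defs.
From mathcomp Require Import all_boot zify.

Set Implicit Arguments.
Unset Strict Implicit.
Unset Printing Implicit Defensive.

(* If a block of [H] has at least four vertices, [H] has a cycle of length at
   least 4, whose edges form a hole in the line graph.  In a tree of maximum
   degree 3 this is impossible: where the path of a vertex of the hole passes
   from its overlap with the preceding path to its overlap with the following
   one, both of these must use the third edge at the branching node, although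
   they represent non-adjacent vertices.
   If all blocks have order at most 3, a breadth-first search from any vertex
   shows that [H] is a rooted tree plus disjoint edges between siblings.
   Replacing every vertex by a leaf hanging from a path along which its child
   blocks branch off gives a tree of maximum degree 3 in which an edge of [H] is
   represented by the path between the leaves of its two ends, and disjoint
   edges get disjoint paths. *)

(** * Holes in orthodox representations *)

Lemma isomorphic_sym (G G' : sgraph) : isomorphic G G' -> isomorphic G' G.
Proof.
case=> f [g fK gK] fE; exists g; first by exists f.
by move=> x y; rewrite -fE !gK.
Qed.

Lemma ORTH_isomorphic (h s t : nat) (G G' : sgraph) :
  isomorphic G G' -> ORTH h s t G -> ORTH h s t G'.
Proof.
case/isomorphic_sym=> f /bij_inj f_inj fE [T [S [Ttree Stree Sleaf Sadj]]].
exists T, (S \o f); split=> // [u | u | u v uv]; first exact: Stree.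
  exact: Sleaf.
by rewrite -fE; apply: Sadj => /f_inj.
Qed.

Lemma sedge_edge (G : sgraph) (K : subgraph G) (x y : G) :
  sedge K x y -> edge x y.
Proof. by case/(sedge_sub (s := K))/and3P. Qed.

Lemma sedge_mem (G : sgraph) (K : subgraph G) (x y : G) :
  sedge K x y -> x \in sverts K /\ y \in sverts K.
Proof. by case/(sedge_sub (s := K))/and3P. Qed.

Lemma edge_neq (G : sgraph) (x y : G) : edge x y -> x != y.
Proof. by apply: contraTneq => ->; rewrite edge_irrefl. Qed.

Lemma card_ge2 (T : finType) (A : {set T}) (x y : T) :
  x \in A -> y \in A -> x != y -> 1 < #|A|.
Proof. by move=> xA yA xy; apply/card_gt1P; exists x, y. Qed.

Lemma connected_neighbor (G : sgraph) (K : subgraph G) (x : G) :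
  connected K -> 1 < #|sverts K| -> x \in sverts K -> exists y, sedge K x y.
Proof.
case=> _ Kconn /card_gt1P[y [z [yK zK yz]]] xK.
have [w wK xw] : exists2 w, w \in sverts K & x != w.
  have [xy|] := eqVneq x y; last by exists y.
  by exists z; rewrite // xy.
have /connectP[[|v p] /= p_path last_p] := Kconn x w xK wK.
  by rewrite last_p eqxx in xw.
by exists v; case/andP: p_path.
Qed.

Lemma degree_gt1_neighbor (G : sgraph) (K : subgraph G) (x y : G) :
  1 < degree K x -> exists2 z, sedge K x z & z != y.
Proof.
case/card_gt1P=> u [v []]; rewrite !inE => xu xv uv.
have [uy|] := eqVneq u y; last by exists u.
by exists v; rewrite // eq_sym -uy.
Qed.

Lemma leaf_neighbor_unique (G : sgraph) (K : subgraph G) (x y z : G) :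
  leaf K x -> sedge K x y -> sedge K x z -> y = z.
Proof.
case=> _ /eqP/cards1P[w def_w] xy xz.
have : y \in [set y | sedge K x y] by rewrite inE.
have : z \in [set y | sedge K x y] by rewrite inE.
by rewrite def_w !inE => /eqP-> /eqP->.
Qed.

Definition del_edge (G : sgraph) (a b : G) : rel G :=
  [rel x y | edge x y && ~~ ((x == a) && (y == b) || (x == b) && (y == a))].

Lemma del_edge_sym (G : sgraph) (a b : G) : symmetric (del_edge a b).
Proof.
move=> x y; rewrite /del_edge /= edge_sym orbC.
by rewrite [(x == b) && _]andbC [(x == a) && _]andbC.
Qed.

(** A shortened path from [a] to [b] that misses the edge [ab] has an inner vertex, so adding that
    edge closes a cycle of length at least 3. *)
Lemma acyclic_bridge (G : sgraph) (a b : G) :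
  acyclic (whole G) -> edge a b -> ~~ connect (del_edge a b) a b.
Proof.
move=> acG ab; apply/negP=> /connectP[p0 p0_path].
case/shortenP: p0_path => p p_path p_uniq _ last_p.
have sub_p : path (@edge G) a p by apply: sub_path p_path => x y /andP[].
have := acG (a :: p); rewrite /ucycle /= rcons_path sub_p -last_p edge_sym ab.
rewrite -[_ && uniq p]/(uniq (a :: p)) p_uniq => /(_ isT).
case: p p_path last_p {p_uniq sub_p} => [|x [|y p]] //= p_path last_p.
  by rewrite last_p edge_irrefl in ab.
by move: p_path; rewrite /del_edge /= last_p /= !eqxx andbF.
Qed.

Lemma sorted_connect (T : finType) (e : rel T) (s : seq T) :
  symmetric e -> sorted e s -> {in s &, forall x y, connect e x y}.
Proof.
move=> e_sym; case: s => // z s s_path x y xs ys.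
have conn_s := path_connect s_path.
by apply: connect_trans (conn_s _ ys); rewrite (sym_connect_sym e_sym) conn_s.
Qed.

(** Used with [P] the edges of one subtree, to find the vertex [w] at which a path starting inside
    that subtree leaves it. The second hypothesis rules out [P] on the last step, so a drop must
    occur. *)
Lemma first_drop (T : Type) (P : rel T) (x y : T) (p : seq T) :
  P x y -> (forall z, ~~ P z (last y p)) ->
  exists q a w b q',
    [/\ x :: y :: p = q ++ a :: w :: b :: q', P a w & ~~ P w b].
Proof.
elim: p x y => [|z p IHp] x y /= Pxy lastP.
  by rewrite (negbTE (lastP x)) in Pxy.
have [Pyz|nPyz] := boolP (P y z); last by exists [::], x, y, z, p.
have [q [a [w [b [q' [-> Paw nPwb]]]]]] := IHp y z Pyz lastP.
by exists (x :: q), a, w, b, q'.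
Qed.

(* Both ends of a path between two leaves have a single neighbour, so the path
   of [u1] starts inside that of [u0] and ends inside that of [u2].  Where it
   leaves the path of [u0] at a vertex [w], the next edge must belong to the
   path of [u2], as otherwise removing it would not disconnect the tree.  Both
   outer paths then continue along the third edge at [w]. *)
Lemma orth_no_hole (s : nat) (G T : sgraph) (S : G -> subgraph T)
    (u0 u1 u2 : G) :
  orth_representation 3 s 2 S -> edge u0 u1 -> edge u1 u2 ->
  u0 <> u2 -> ~~ edge u0 u2 ->
  ~~ connect [rel x y | edge x y &&
       ((x == u0) || (x == u2) || (x != u1) && ~~ edge x u1) &&
       ((y == u0) || (y == u2) || (y != u1) && ~~ edge y u1)] u0 u2.
Proof.
case=> [[[_ acT] degT] Stree Sleaf Sadj] e01 e12 /eqP u02 ne02.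
pose ok u := (u == u0) || (u == u2) || (u != u1) && ~~ edge u u1.
have share u v x y : u != v -> ~~ edge u v -> x != y ->
    x \in sverts (S u) -> y \in sverts (S u) ->
    x \in sverts (S v) -> y \in sverts (S v) -> False.
  move=> /eqP uv /negP nuv xy xu yu xv yv; apply: nuv.
  by apply/(Sadj u v uv).1; apply: (card_ge2 (x := x) (y := y)); rewrite ?inE ?xu ?yu.
have edge_leaf u v : edge u v -> exists x,
    [/\ leaf (whole T) x, x \in sverts (S u) & x \in sverts (S v)].
  by move=> uv; apply/(Sadj u v _).2 => // Euv; rewrite Euv edge_irrefl in uv.
have S_gt1 u v : edge u v -> 1 < #|sverts (S u)|.
  move=> uv; have /(Sadj u v _).1 : edge u v by [].
  move=> /(_ (elimN eqP (edge_neq uv))) /leq_trans; apply.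
  exact: subset_leq_card (subsetIl _ _).
have [x0 [x0T x0_0 x0_1]] := edge_leaf _ _ e01.
have [x1 [x1T x1_1 x1_2]] := edge_leaf _ _ e12.
have x1_0 : x1 \notin sverts (S u0).
  apply: contra ne02 => x1_0.
  by apply/(Sadj u0 u2 (elimN eqP u02)).2; exists x1.
have [[S1conn _] _] := Stree u1.
have /connectP[p0 p0_path] := S1conn.2 _ _ x0_1 x1_1.
case/shortenP: p0_path => p p_path p_uniq _ last_p.
case: p p_path p_uniq last_p => [|y p] p_path p_uniq last_p.
  by rewrite last_p /= x0_0 in x1_0.
(* [S u0] has an edge at [x0], and the leaf [x0] of the tree has only one neighbour, so this edge is
   the first edge of the path. *)
have S0y : sedge (S u0) x0 y.
  have [[S0conn _] _] := Stree u0.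
  have [z x0z] := connected_neighbor S0conn (S_gt1 _ _ e01) x0_0.
  case/andP: p_path => x0y _.
  by rewrite (leaf_neighbor_unique (y := y) (z := z) x0T) //=; apply: sedge_edge; eauto.
have [z|q [a [w [b [q' [def_p aw0 nwb0]]]]]] := first_drop S0y (p := p).
  by apply: contra x1_0; rewrite last_p => /sedge_mem[].
apply/negP=> conn02.
have uniq_p : uniq (q ++ a :: w :: b :: q') by rewrite -def_p.
have : sorted (sedge (S u1)) (x0 :: y :: p) by [].
have x0_p : x0 \in (rcons q a) ++ [:: w].
  by case: (q) def_p => [|z q0] [-> _]; rewrite ?mem_cat mem_head.
have x1_p : x1 \in b :: q'.
  by rewrite last_p -[last _ _]/(last x0 (x0 :: y :: p)) def_p last_cat /= mem_last.
rewrite def_p => sort_p.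
have wb1 : sedge (S u1) w b by case/cat_sorted2: sort_p => _ /= /and3P[].
have [w1 b1] := sedge_mem wb1; have wb := sedge_edge wb1.
have ab : a != b.
  move: uniq_p; rewrite cat_uniq /= !inE !negb_or => /and3P[_ _].
  by case/andP=> /and3P[].
rewrite -cat_rcons -cat1s catA in sort_p uniq_p.
have [sort1 sort2] := cat_sorted2 sort_p.
have disj x : x \in b :: q' -> x \notin rcons q a ++ [:: w].
  by move: uniq_p; rewrite cat_uniq => /and3P[_ /hasPn disj _] /disj.
(* The part of the path up to [w] misses [b], and the part from [b] on misses [w]; hence neither
   part uses the edge [wb]. *)
have del_conn1 : connect (del_edge w b) x0 w.
  apply: (sorted_connect (@del_edge_sym T w b) (s := rcons q a ++ [:: w])) => //; last first.
    by rewrite mem_cat mem_head orbT.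
  apply: (sub_in_sorted (P := predC1 b)) sort1.
    by move=> x z; rewrite !inE /del_edge /= => xb zb /sedge_edge->; rewrite (negbTE xb) (negbTE zb) andbF.
  by apply/allP=> x x_p; apply: contraTneq x_p => ->; apply: (disj b); apply: mem_head.
have del_conn2 : connect (del_edge w b) b x1.
  apply: (sorted_connect (@del_edge_sym T w b) (s := b :: q')) => //; last first.
    by rewrite mem_head.
  apply: (sub_in_sorted (P := predC1 w)) sort2.
    by move=> x z; rewrite !inE /del_edge /= => xw zw /sedge_edge->; rewrite (negbTE xw) (negbTE zw) andbF.
  by apply/allP=> x /disj; apply: contraNneq => ->; rewrite mem_cat mem_head orbT.
have [a0 w0] := sedge_mem aw0.
(* Otherwise the subtrees along the chain from [u0] to [u2] join [x0] to [x1] without the bridge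
   [wb]. [S u0] lacks this edge by the choice of [w], [S u2] by assumption, and the others because a
   vertex not adjacent to [u1] cannot share both [w] and [b] with it. *)
have wb2 : sedge (S u2) w b.
  apply: contraT => nwb2.
  have ok_del u : ok u -> {in sverts (S u) &, forall x z, connect (del_edge w b) x z}.
    move=> ok_u x z xu zu; have [[Sconn _] _] := Stree u.
    apply: connect_sub (Sconn.2 _ _ xu zu) => {xu zu}{}x {}z xz; apply: connect1.
    rewrite /del_edge /= (sedge_edge xz) /=.
    have nwb : ~~ sedge (S u) w b.
      case/orP: ok_u => [/orP[]/eqP-> // | /andP[uu1 nuu1]].
      by apply/negP => /sedge_mem[wu bu]; apply: (share u u1 w b) => //; apply: edge_neq.
    by apply/negP=> /orP[]/andP[/eqP xE /eqP zE]; move: nwb xz; rewrite xE zE 1?sedge_sym => /negP.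
  have conn_S u : connect [rel x y | edge x y && ok x && ok y] u0 u ->
      ok u -> {in sverts (S u), forall x, connect (del_edge w b) x0 x}.
    case/connectP=> r; elim/last_ind: r u => [|r z IHr] u /=.
      by move=> _ -> ok0 x xu; apply: (ok_del u0).
    rewrite rcons_path last_rcons => /andP[r_path /andP[/andP[lz ok_l] ok_z]] -> _ x xz.
    have [v [_ vl vz]] := edge_leaf _ _ lz.
    by apply: connect_trans (IHr _ r_path erefl ok_l v vl) (ok_del z ok_z _ _ vz xz).
  have := acyclic_bridge acT wb; rewrite -(same_connect (sym_connect_sym (@del_edge_sym T w b)) del_conn1).
  rewrite (sym_connect_sym (@del_edge_sym T w b)) (same_connect (sym_connect_sym (@del_edge_sym T w b)) del_conn2).
  rewrite (sym_connect_sym (@del_edge_sym T w b)) (conn_S u2) //.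
  by rewrite /ok eqxx orbT.
have wT : ~ leaf (whole T) w.
  move=> wT; case/eqP: ab; apply: (leaf_neighbor_unique wT) => //=.
  by rewrite edge_sym; apply: sedge_edge aw0.
(* A leaf of [S u] is a leaf of the tree, which [w] is not, so a subtree with an edge at [w] has a
   second one there. *)
have other u z : sedge (S u) w z -> exists2 c, sedge (S u) w c & c != z.
  move=> wz; apply: degree_gt1_neighbor.
  rewrite ltn_neqAle eq_sym; apply/andP; split.
    by apply/eqP=> wdeg; apply/wT/(Sleaf u); split=> //; case/sedge_mem: wz.
  by rewrite /degree card_gt0; apply/set0Pn; exists z; rewrite inE.
have wa0 : sedge (S u0) w a by rewrite sedge_sym.
have [c wc0 ca] := other u0 a wa0.
have [c' wc2 c'b] := other u2 b wb2.
have [w2 c'2] := sedge_mem wc2; have [_ c0] := sedge_mem wc0.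
have aw := edge_neq (sedge_edge aw0); have cw := edge_neq (sedge_edge wc0).
have cb : c != b by apply: contraNneq nwb0 => <-.
have c'a : c' != a.
  by apply/eqP=> c'a; apply: (share u0 u2 w a) => //; rewrite 1?eq_sym // -c'a.
have cc' : c != c'.
  apply/eqP=> cc'; apply: (share u0 u2 w c) => //; by rewrite cc'.
(* Since [S u0] and [S u2] share no two vertices, the continuations [c] and [c'] differ, and [w] has
   four neighbours. *)
have /(_ w (in_setT w)) := degT; rewrite leqNgt => /negP; apply.
have <- : #|[set a; b; c; c']| = 4.
  by rewrite -!setUA !cardsU1 !inE !negb_or cards1 ab cc' !(eq_sym a) !(eq_sym b) ca cb c'a c'b.
apply/subset_leq_card/subsetP=> x; rewrite !inE -!orbA /=.
by case/or4P=> /eqP-> //; apply: sedge_edge; eassumption.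
Qed.

(** * Cycles and blocks *)

Definition avoid (G : sgraph) (b c : G) : rel G :=
  [rel x y | [&& edge x y, x \notin [:: b; c] & y \notin [:: b; c]]].

(* A cycle of length at least 4 through the consecutive vertices a, b, c, d. *)
Definition long_cycle (G : sgraph) (a b c d : G) : bool :=
  [&& edge a b, edge b c, edge c d, uniq [:: a; b; c; d]
    & connect (avoid b c) a d].

Lemma edge_setP (H : sgraph) (A : {set H}) :
  reflect (exists x y, edge x y /\ A = [set x; y]) (A \in edge_set H).
Proof.
apply: (iffP imsetP) => [[[x y]] | [x [y [xy ->]]]].
  by rewrite inE /= => xy ->; exists x, y.
by exists (x, y); rewrite ?inE.
Qed.

Lemma mem_edge_set (H : sgraph) (x y : H) :
  edge x y -> [set x; y] \in edge_set H.
Proof. by move=> xy; apply/edge_setP; exists x, y. Qed.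

Definition line_of (H : sgraph) (x y : H) (xy : edge x y) : line_graph H :=
  Sub [set x; y] (mem_edge_set xy).

Lemma line_edge_share (H : sgraph) (e f : line_graph H) (x : H) :
  e != f -> x \in val e -> x \in val f -> edge e f.
Proof.
move=> ef xe xf; rewrite /= /line_edge /= ef.
by apply/set0Pn; exists x; rewrite inE xe.
Qed.

(** The edges [ab], [bc], [cd] serve as [u0], [u1], [u2] in [orth_no_hole]. The edges of a path from
    [a] to [d] that avoids [b] and [c] are disjoint from [bc], hence not adjacent to [u1], and they
    form the forbidden chain. *)
Lemma ORTH_no_long_cycle (s : nat) (H : sgraph) (a b c d : H) :
  ORTH 3 s 2 (line_graph H) -> ~~ long_cycle a b c d.
Proof.
case=> T [S repS]; apply/negP=> /and5P[ab bc cd].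
rewrite /= !inE !negb_or andbT => /and3P[/and3P[nab nac nad] /andP[nbc nbd] ncd].
move=> conn_ad.
pose u0 := line_of ab; pose u1 := line_of bc; pose u2 := line_of cd.
pose ok (w : line_graph H) :=
  (w == u0) || (w == u2) || (w != u1) && ~~ edge w u1.
have e01 : edge u0 u1.
  apply: (line_edge_share (x := b)); rewrite ?inE ?eqxx ?orbT //.
  apply/eqP=> /(congr1 val)/= /setP/(_ a).
  by rewrite !inE eqxx (negbTE nab) (negbTE nac).
have e12 : edge u1 u2.
  apply: (line_edge_share (x := c)); rewrite ?inE ?eqxx ?orbT //.
  apply/eqP=> /(congr1 val)/= /setP/(_ b).
  by rewrite !inE eqxx (negbTE nbc) (negbTE nbd).
have disj02 x : x \in val u0 -> x \notin val u2.
  rewrite !inE => /orP[]/eqP->.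
    by rewrite (negbTE nac) (negbTE nad).
  by rewrite (negbTE nbc) (negbTE nbd).
have u02 : u0 <> u2.
  by move=> E; have := disj02 a; rewrite -E !inE eqxx => /(_ isT).
have ne02 : ~~ edge u0 u2.
  apply/negP=> /andP[_ /set0Pn[x]]; rewrite inE => /andP[/disj02/negbTE].
  by move=> ->.
have /negP := orth_no_hole repS e01 e12 u02 ne02; apply.
set r := [rel x y | _].
have ok_conn e f x : ok e -> ok f -> x \in val e -> x \in val f -> connect r e f.
  move=> ok_e ok_f xe xf; have [->|ef] := eqVneq e f; first exact: connect0.
  apply: connect1; rewrite /r /= -/(ok e) -/(ok f) ok_e ok_f !andbT.
  exact: (line_edge_share ef xe xf).
have ok_avoid x y (xy : edge x y) : avoid b c x y -> ok (line_of xy).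
  case/and3P=> _; rewrite !inE !negb_or => /andP[xb xc] /andP[yb yc].
  have disj z : z \in val (line_of xy) -> z \notin val u1.
    by rewrite !inE => /orP[]/eqP->; apply/norP.
  apply/orP; right; apply/andP; split.
    apply/eqP=> E; have := disj x; rewrite -E !inE eqxx => /(_ isT).
    by [].
  apply/negP=> /andP[_ /set0Pn[z]]; rewrite inE => /andP[/disj/negbTE].
  by move=> ->.
have ok0 : ok u0 by rewrite /ok eqxx.
have ok2 : ok u2 by rewrite /ok eqxx orbT.
(* The induction carries an admissible edge [e] at the current vertex [x]; it starts from [u0] at
   [a] and ends in [u2] at [d]. *)
have path_conn p x e : path (avoid b c) x p -> ok e -> x \in val e ->
    last x p = d -> connect r e u2.
  elim: p x e => [|y p IHp] x e /=.
    by move=> _ ok_e xe xd; apply: (ok_conn e u2 x); rewrite // xd !inE eqxx orbT.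
  case/andP=> xy p_path ok_e xe last_p.
  have Exy : edge x y by case/andP: xy.
  have ok_xy := ok_avoid x y Exy xy.
  apply: connect_trans (IHp y (line_of Exy) p_path ok_xy _ last_p).
    by apply: (ok_conn e _ x); rewrite // !inE eqxx.
  by rewrite !inE eqxx orbT.
case/connectP: conn_ad => p p_path last_p.
by apply: path_conn p_path ok0 _ _; rewrite // !inE eqxx.
Qed.

(** If adjacency in [K] is transitive on distinct vertices, [K] is complete and any four vertices
    form a cycle. Otherwise some [x], [y], [z] is a path with [xz] not an edge of [K]; as [y] is not
    a cut vertex, another path joins [x] to [z] around [y]. *)
Lemma nonseparable_long_cycle (G : sgraph) (K : subgraph G) :
  nonseparable K -> 3 < #|sverts K| ->
  exists a b c d : G, long_cycle a b c d.
Proof.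
move=> [[_ Kconn] Kcut] K_gt3.
case: (boolP [forall x, forall y, forall z,
  [&& sedge K x y, sedge K y z & x != z] ==> sedge K x z]) => [/forallP trans | ].
  have complete x y : connect (sedge K) x y -> x != y -> sedge K x y.
    case/connectP=> p; elim/last_ind: p y => [|p z IHp] y /=.
      by move=> _ ->; rewrite eqxx.
    rewrite rcons_path last_rcons => /andP[p_path lz] -> xz.
    have [xl|xl] := eqVneq x (last x p); first by rewrite {1}xl.
    have /forallP/(_ (last x p))/forallP/(_ z)/implyP := trans x; apply.
    by rewrite (IHp _ p_path erefl xl) lz xz.
  have := enum_uniq (sverts K); have: 3 < size (enum (sverts K)) by rewrite -cardE.
  have: {subset enum (sverts K) <= sverts K} by move=> x; rewrite mem_enum.
  case: (enum _) => [|a [|b [|c [|d s]]]] // sub_K _.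
  have adj x y : x \in [:: a; b; c; d] -> y \in [:: a; b; c; d] -> x != y -> edge x y.
    move=> xs ys xy; apply: (@sedge_edge _ K); apply: complete => //.
    by apply: Kconn; apply: sub_K; rewrite -[[:: a, b, c, d & s]]/([:: a; b; c; d] ++ s) mem_cat ?xs ?ys.
  rewrite -[[:: a, b, c, d & s]]/([:: a; b; c; d] ++ s) cat_uniq.
  move=> /andP[abcd _]; exists a, b, c, d; rewrite /long_cycle abcd.
  move: abcd; rewrite /= !inE !negb_or andbT => /and3P[/and3P[nab nac nad] /andP[nbc nbd] ncd].
  rewrite !adj ?inE ?eqxx ?orbT //=; apply: connect1.
  rewrite /avoid /= adj ?inE ?eqxx ?orbT // !negb_or nab nac.
  by rewrite !(eq_sym d) nbd ncd.
case/forallPn=> x /forallPn[y] /forallPn[z].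
rewrite negb_imply => /andP[/and3P[xy yz xz] nxz].
have [xK yK] := sedge_mem xy; have [_ zK] := sedge_mem yz.
have : connect (sedge (delete_vertex K y)) x z.
  apply: contraT => nconn; case: (Kcut y); split=> //; exists x, z; split=> //.
  - by rewrite !inE (edge_neq (sedge_edge xy)).
  - by rewrite !inE eq_sym (edge_neq (sedge_edge yz)).
  - exact: Kconn.
case/connectP=> p0 p0_path; case/shortenP: p0_path => p p_path p_uniq _.
case/lastP: p p_path p_uniq => [|p w]; first by move=> _ _ /= E; rewrite E eqxx in xz.
rewrite rcons_path last_rcons -rcons_cons rcons_uniq => /andP[p_path lw] + zw.
rewrite -{w}zw in lw *; move=> /andP[zp p_uniq].
case/and3P: lw => lz ly _.
have p_neq : {in p, forall w, w != x}.
  by move=> w wp; apply: contraTneq wp => ->; case/andP: p_uniq.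
(* Here [p] has lost its end [z], so the fourth vertex is the one before [z] on the path. It differs
   from [x] because [K] has no edge [xz]. *)
exists x, y, z, (last x p); rewrite /long_cycle.
rewrite (sedge_edge xy) (sedge_edge yz) edge_sym (sedge_edge lz) /=.
rewrite !inE !negb_or (edge_neq (sedge_edge xy)) xz (edge_neq (sedge_edge yz)) /=.
have -> : x != last x p.
  case: p {p_path zp p_uniq ly} lz p_neq => [|w p] /= lz p_neq.
    by rewrite lz in nxz.
  by rewrite eq_sym p_neq ?mem_last.
have -> /= : z != last x p by apply: contraNneq zp => ->; rewrite mem_last.
rewrite eq_sym ly /=.
apply/connectP; exists p => //.
apply: (sub_in_path (P := predC1 z)) p_path; last first.
  by apply/allP=> w wp; apply: contraNneq zp => <-.
move=> u v; rewrite !inE /avoid => uz vz /and3P[uv uy vy] /=.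
by rewrite (sedge_edge uv) !inE !negb_or uy uz vy vz.
Qed.

(** * Induced subgraphs, cycles and the order of blocks *)

Section Induced.
Variables (G : sgraph) (A : {set G}).

Definition induced_edge : rel G := [rel x y | [&& edge x y, x \in A & y \in A]].

Lemma induced_edge_sym : symmetric induced_edge.
Proof. by move=> x y; rewrite /induced_edge /= edge_sym [(x \in A) && _]andbC. Qed.

Lemma induced_edge_sub (x y : G) :
  induced_edge x y -> [&& edge x y, x \in A & y \in A].
Proof. by []. Qed.

Definition induced : subgraph G := Subgraph induced_edge_sym induced_edge_sub.

End Induced.

Lemma subgraph_le_induced (G : sgraph) (K : subgraph G) :
  subgraph_le K (induced (sverts K)).
Proof. by split=> // x y /(sedge_sub (s := K)). Qed.

(** Adding edges on the same vertices neither disconnects [K] nor creates a cut vertex. This lets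
    nonseparable subgraphs be handled through their vertex sets. *)
Lemma nonseparable_induced (G : sgraph) (K : subgraph G) :
  nonseparable K -> nonseparable (induced (sverts K)).
Proof.
move=> [[K0 Kconn] Kcut]; have [_ sub_e] := subgraph_le_induced K.
split; first split=> // x y xK yK.
  by apply: connect_sub (Kconn x y xK yK) => u v /sub_e; apply: connect1.
move=> v [vK [x [y [xK yK _ /negP nxy]]]]; apply: (Kcut v); split=> //.
exists x, y; split=> //.
  by apply: Kconn; [move: xK | move: yK]; rewrite !inE => /andP[].
apply/negP=> conn; apply: nxy; apply: connect_sub conn => a b.
by case/and3P=> /sub_e ab av bv; apply: connect1; apply/and3P.
Qed.

(** Induction on the number of vertices outside [A]. A counterexample would be a block itself: a
    nonseparable subgraph above it has either the same vertices, hence no further edges, or more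
    vertices, which the induction excludes. *)
Lemma nonseparable_induced_card (G : sgraph) (n : nat) (A : {set G}) :
  (forall B : subgraph G, block B -> #|sverts B| <= n) ->
  nonseparable (induced A) -> #|A| <= n.
Proof.
move=> block_le; have [k] := ubnP (#|G| - #|A|).
elim: k A => // k IHk A leAk nsA; apply: contraT; rewrite -ltnNge => A_gt.
suff /block_le : block (induced A) by rewrite leqNgt A_gt.
split=> // K' nsK' [/= sAK' _].
have [EA|nEA] := eqVneq A (sverts K').
  rewrite EA; exact: subgraph_le_induced.
have ltA : #|A| < #|sverts K'|.
  by rewrite proper_card // properEneq nEA.
suff : #|sverts K'| <= n by rewrite leqNgt (ltn_trans A_gt ltA).
apply: IHk (nonseparable_induced nsK'); apply: leq_trans (ltnSE leAk).
by rewrite ltn_sub2l // (leq_trans ltA) ?max_card.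
Qed.

Lemma ucycle_nonseparable (G : sgraph) (x : G) (c : seq G) :
  ucycle (@edge G) (x :: c) -> nonseparable (induced [set y in x :: c]).
Proof.
move=> /andP[c_cyc c_uniq]; split; first split.
- by apply/set0Pn; exists x; rewrite inE mem_head.
- move=> y z; rewrite !inE -!in_cons => yc zc.
  apply: (sorted_connect (@induced_edge_sym G _) (s := x :: c)) => //.
  apply: (sub_in_sorted (P := mem (x :: c)) (e := @edge G)); first last.
  + by move: c_cyc; rewrite /= rcons_path => /andP[].
  + by apply/allP.
  by move=> a b ac bc ab; apply/and3P; split; rewrite // inE.
move=> v [vc [y [z [yc zc _ /negP]]]]; apply.
(* Rotating the cycle to start at the deleted vertex [v] leaves a path [p] through all the other
   vertices. *)
rewrite /= inE in vc; have [i p def_p] := rot_to vc.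
have mem_p u : u \in p = (u != v) && (u \in x :: c).
  rewrite -(mem_rot i (x :: c)) def_p inE; have [->|//] := eqVneq u v.
  by move: c_uniq; rewrite -(rot_uniq i) def_p => /andP[/negbTE].
apply: (sorted_connect (@delete_edge_sym G (induced [set y in x :: c]) v) (s := p)).
- apply: (sub_in_sorted (P := mem p) (e := @edge G)); first last.
  + move: c_cyc; rewrite -(rot_cycle i) def_p /= rcons_path => /andP[/path_sorted//].
  + by apply/allP.
  move=> a b; rewrite -![_ \in mem p]/(_ \in p) !mem_p => /andP[av ac] /andP[bv bc] ab.
  by apply/and3P; split=> //; apply/and3P; split; rewrite // inE.
- by move: yc; rewrite !inE mem_p !inE.
- by move: zc; rewrite !inE mem_p !inE.
Qed.

Lemma blocks_no_long_cycle (G : sgraph) (a b c d : G) :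
  (forall B : subgraph G, block B -> #|sverts B| <= 3) -> ~~ long_cycle a b c d.
Proof.
move=> block_le; apply/negP=> /and5P[ab bc cd abcd /connectP[p0 p0_path]].
case/shortenP: p0_path => p p_path p_uniq _ last_p.
have p_avoid : {in a :: p, forall x, x \notin [:: b; c]}.
  move=> x; rewrite inE => /predU1P[->|xp].
    by move: abcd; rewrite /= !inE !negb_or => /and3P[/and3P[-> ->]].
  case: (p) xp p_path => // y q yq /= /andP[/and3P[_ _ y_av] q_path].
  move: yq; rewrite inE => /predU1P[-> //|xq].
  elim: q y {y_av} q_path xq => // z q IHq y /= /andP[/and3P[_ _ z_av] q_path].
  by rewrite inE => /predU1P[-> // | /(IHq _ q_path)].
(* The order is [b], [a], then the path to [d], then [c]. As [a] and [d] differ, [p] is nonempty and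
   the cycle has at least four vertices. *)
have cyc : ucycle (@edge G) [:: b, a & rcons p c].
  rewrite /ucycle /= rcons_path last_rcons rcons_path -last_p edge_sym ab.
  rewrite [edge d c]edge_sym cd [edge c b]edge_sym bc.
  have -> : path (@edge G) a p by apply: sub_path p_path => x y /andP[].
  rewrite !inE !mem_rcons !inE rcons_uniq !negb_or /=.
  have notin x : x \in [:: b; c] -> x \notin a :: p.
    by apply: contraL => /p_avoid.
  move: abcd; rewrite /= !inE !negb_or => /and3P[/and3P[nab nac nad] /andP[nbc nbd] _].
  rewrite eq_sym nab nbc nac; have /andP[-> ->] : (a \notin p) && uniq p by [].
  have := notin b; have := notin c; rewrite !inE !eqxx orbT !negb_or.
  by case/(_ isT)/andP=> _ -> /(_ isT)/andP[_ ->].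
have := nonseparable_induced_card block_le (ucycle_nonseparable cyc).
rewrite leqNgt => /negP; apply.
rewrite cardsE (card_uniqP (andP cyc).2) /= size_rcons.
case: (p) last_p => //= da; move: abcd; rewrite da /= !inE eqxx !orbT /=.
by [].
Qed.

(** * Breadth-first layering *)

(** [d] is the least radius of a ball around [r] that contains the vertex, and [pi] picks a
    neighbour in the previous ball. *)
Lemma bfs_layering (H : sgraph) (r : H) :
  connected (whole H) ->
  exists (d : H -> nat) (pi : H -> H),
    [/\ forall v, (d v == 0) = (v == r),
        forall v, v != r -> edge (pi v) v /\ d v = (d (pi v)).+1
      & forall u v, edge u v -> d v <= (d u).+1].
Proof.
case=> _ Hconn.
pose grow (A : {set H}) := [set y | [exists x in A, (x == y) || edge x y]].
pose ball n := iter n grow [set r].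
have ballS n y : (y \in ball n.+1) = [exists x in ball n, (x == y) || edge x y].
  by rewrite /ball iterS inE.
have in_ball v : exists n, v \in ball n.
  have /connectP[p] := Hconn r v (in_setT r) (in_setT v).
  elim/last_ind: p v => [|p z IHp] v /=; first by move=> _ ->; exists 0; rewrite inE.
  rewrite rcons_path last_rcons => /andP[p_path lz] ->.
  have [n ln] := IHp _ p_path erefl; exists n.+1; rewrite ballS.
  by apply/existsP; exists (last r p); rewrite ln lz orbT.
have /fin_all_exists[d d_min] v : exists n,
    v \in ball n /\ forall k, v \in ball k -> n <= k.
  by case: (ex_minnP (in_ball v)) => n vn n_min; exists n.
have d_edge u v : edge u v -> d v <= (d u).+1.
  move=> uv; apply: (d_min v).2; rewrite ballS; apply/existsP; exists u.
  by rewrite (d_min u).1 uv orbT.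
have d0 v : (d v == 0) = (v == r).
  apply/eqP/eqP=> [dv|->]; first by have := (d_min v).1; rewrite dv inE => /eqP.
  by apply/eqP; rewrite -leqn0; apply: (d_min r).2; rewrite inE.
have /fin_all_exists[pi pi_def] v : exists u,
    v != r -> edge u v /\ d v = (d u).+1.
  have [->|vr] := eqVneq v r; first by exists r.
  case def_dv: (d v) => [|n]; first by rewrite -d0 def_dv eqxx in vr.
  have [+ v_min] := d_min v; rewrite def_dv ballS.
  case/existsP=> u /andP[un /predU1P[uv|uv]].
    by have := v_min n; rewrite -{1}uv un def_dv ltnn => /(_ isT).
  exists u => _; split=> //; congr _.+1; apply/eqP; rewrite eqn_leq.
  by rewrite (d_min u).2 // andbT -ltnS -def_dv d_edge.
by exists d, pi; split.
Qed.

(* [H] is a breadth-first tree with parent map [pi] together with disjoint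
   edges between siblings; [rep] selects one vertex from each pair of adjacent
   siblings and fixes all other vertices. *)
Record layering (H : sgraph) (r : H) (d : H -> nat) (pi rep : H -> H) : Prop :=
  Layering {
    lay_depth : forall v, v != r -> d v = (d (pi v)).+1;
    lay_edge : forall u v, edge u v ->
      [\/ v != r /\ u = pi v, u != r /\ v = pi u
        | [/\ u != r, v != r, pi u = pi v & rep u = rep v]];
    lay_rep_root : forall v, (rep v == r) = (v == r);
    lay_rep_pi : forall v, pi (rep v) = pi v;
    lay_rep_depth : forall v, d (rep v) = d v;
    lay_rep_card : forall x, #|[set y | rep y == x]| <= 2 }.

(** Three configurations would each produce a long cycle: adjacent vertices of one level with
    different parents, a vertex with two neighbours in the level above it, and a vertex with two
    neighbours in its own level. *)
Lemma no_long_cycle_layering (H : sgraph) (r : H) :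
  connected (whole H) -> (forall a b c d : H, ~~ long_cycle a b c d) ->
  exists (d : H -> nat) (pi rep : H -> H), layering r d pi rep.
Proof.
move=> /(bfs_layering r)[d [pi [d0 pi_def d_edge]]] noLC.
have pi_edge v : v != r -> edge (pi v) v by move/pi_def=> [].
have pi_d v : v != r -> d v = (d (pi v)).+1 by move/pi_def=> [].
(* Parent steps decrease the depth, so all vertices of depth below [k] are joined through the root
   below [k]. Such connections avoid any [b], [c] of depth at least [k]. *)
pose low k := [rel x y | [&& edge x y, d x < k & d y < k]].
have low_sym k : symmetric (low k).
  by move=> x y; rewrite /= edge_sym [(d x < k) && _]andbC.
have low_root k x : d x < k -> connect (low k) x r.
  have [n] := ubnP (d x); elim: n x => // n IHn x.
  have [-> _ _|xr] := eqVneq x r; first exact: connect0.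
  rewrite ltnS => dxn dxk; have dx := pi_d x xr.
  have dpk : d (pi x) < k by apply: leq_trans dxk; rewrite dx.
  apply: connect_trans (IHn (pi x) _ dpk); last by rewrite -dx.
  by apply: connect1; rewrite /= edge_sym pi_edge // dxk.
have low_avoid k b c x y : d x < k -> d y < k -> k <= d b -> k <= d c ->
    connect (avoid b c) x y.
  move=> xk yk kb kc; have: connect (low k) x y.
    apply: connect_trans (low_root _ _ xk) _.
    by rewrite (sym_connect_sym (low_sym k)) low_root.
  apply: connect_sub => u v /and3P[uv uk vk]; apply: connect1.
  rewrite /avoid /= uv !inE !negb_or.
  have neq w z : d w < k -> k <= d z -> w != z.
    by move=> wk kz; apply: contraTneq (leq_trans wk kz) => ->; rewrite ltnn.
  by rewrite !neq.
have neq_d x y : d x != d y -> x != y by apply: contraNneq => ->.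
have level_neq u v : edge u v -> d u = d v -> u != r /\ v != r.
  move=> uv duv; rewrite -!d0 -duv; suff: d u != 0 by [].
  apply: contraTneq (edge_neq uv) => du.
  have /eqP-> : u == r by rewrite -d0 du.
  by have /eqP-> : v == r; rewrite ?eqxx // -d0 -duv du.
have level_pi u v : edge u v -> d u = d v -> pi u = pi v.
  move=> uv duv; have [ur vr] := level_neq u v uv duv.
  apply/eqP; apply: contraT => npi.
  have du := pi_d u ur; have dv := pi_d v vr.
  have := noLC (pi u) u v (pi v); rewrite /long_cycle pi_edge // uv.
  rewrite edge_sym pi_edge // (low_avoid (d u)) /=; try lia.
  by rewrite !inE !negb_or npi (edge_neq uv) !neq_d //; lia.
have up_pi u v : edge u v -> d v = (d u).+1 -> u = pi v.
  move=> uv duv; apply/eqP; apply: contraT => npi.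
  have vr : v != r by rewrite -d0 duv.
  have dv := pi_d v vr; have dpi : d (pi v) = d u by lia.
  have ur : u != r.
    apply: contraNneq npi => ur; rewrite ur eq_sym -d0 dpi d0 ur eqxx //.
  have pr : pi v != r by rewrite -d0 dpi d0.
  have du := pi_d u ur; have dp := pi_d _ pr.
  have := noLC (pi u) u v (pi v); rewrite /long_cycle pi_edge // uv.
  rewrite edge_sym pi_edge //=.
  rewrite !inE !negb_or npi (edge_neq uv) !neq_d /=; try lia.
  apply: contraNT => _; apply: (connect_trans (y := pi (pi v))).
    by apply: (low_avoid (d u)); lia.
  apply: connect1; rewrite /avoid /= pi_edge // !inE !negb_or.
  by rewrite (eq_sym (pi v)) npi !neq_d //; lia.
have level_unique u v w : edge u v -> edge u w -> d u = d v -> d u = d w -> v = w.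
  move=> uv uw duv duw; apply/eqP; apply: contraT => nvw.
  have [ur vr] := level_neq u v uv duv; have [_ wr] := level_neq u w uw duw.
  have dv := pi_d v vr.
  have puv := level_pi u v uv duv; have puw := level_pi u w uw duw.
  (* The three vertices have the same parent, so the edge from [w] to it closes the cycle. *)
  have := noLC (pi v) v u w; rewrite /long_cycle pi_edge // edge_sym uv uw /=.
  rewrite !inE !negb_or nvw (edge_neq uw) (eq_sym v u) (edge_neq uv) !neq_d /=; try lia.
  apply: contraNT => _; apply: connect1.
  rewrite /avoid /= !inE !negb_or -puv puw pi_edge //.
  by rewrite -puw puv [w == v]eq_sym nvw [w == u]eq_sym (edge_neq uw) !neq_d //; lia.
(* By [level_unique] this is an equivalence with classes of at most two vertices. *)
pose sib v w := (v == w) || edge v w && (d v == d w).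
have sib_sym : symmetric sib by move=> v w; rewrite /sib eq_sym edge_sym [d v == _]eq_sym.
have sib_trans : transitive sib.
  move=> v u w /predU1P[-> //|/andP[uv /eqP duv]] /predU1P[<-|/andP[vw /eqP dvw]].
    by rewrite /sib uv duv eqxx orbT.
  by rewrite /sib (level_unique v u w) ?eqxx // edge_sym.
have sib_d v w : sib v w -> d v = d w by case/predU1P=> [-> // | /andP[_ /eqP]].
have sib_pi v w : sib v w -> pi v = pi w.
  by case/predU1P=> [-> // | /andP[vw /eqP]]; apply: level_pi.
(* [pick] depends only on the class, so siblings in one class get the same representative; the
   default never occurs because [sib] is reflexive. *)
pose rep v := odflt v [pick w | sib v w].
have rep_sib v : sib v (rep v).
  by rewrite /rep; case: pickP => //= /(_ v); rewrite /sib eqxx.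
have sib_rep v w : sib v w -> rep v = rep w.
  move=> vw; rewrite /rep (eq_pick (Q := sib w)).
    by case: pickP => //= /(_ w); rewrite /sib eqxx.
  move=> u; apply/idP/idP; last exact: sib_trans.
  by apply: sib_trans; rewrite sib_sym.
exists d, pi, rep; split=> [v /pi_d // | u v uv | v | v | v | x].
- have := d_edge u v uv; have := d_edge v u; rewrite edge_sym => /(_ uv) dvu duv.
  have [duv1|] := eqVneq (d v) (d u).+1.
    by constructor 1; rewrite -d0 duv1; split=> //; apply: up_pi.
  have [dvu1 _|nd1 nd2] := eqVneq (d u) (d v).+1.
    by constructor 2; rewrite -d0 dvu1; split=> //; apply: up_pi; rewrite // edge_sym.
  have E : d u = d v by lia.
  have [ur vr] := level_neq u v uv E; constructor 3; split=> //.
    exact: level_pi.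
  by apply: sib_rep; rewrite /sib uv E eqxx orbT.
- by rewrite -!d0 -(sib_d _ _ (rep_sib v)).
- exact/esym/sib_pi.
- exact/esym/sib_d.
have sub : [set y | rep y == x] \subset x |: [set y | edge x y && (d x == d y)].
  apply/subsetP=> y; rewrite !inE => /eqP yx.
  by have := rep_sib y; rewrite yx sib_sym /sib eq_sym.
apply: leq_trans (subset_leq_card sub) _.
apply: leq_trans (leq_card_setU _ _) _; rewrite cards1 ltnS.
apply/card_le1_eqP=> u v; rewrite !inE => /andP[xu /eqP dxu] /andP[xv /eqP dxv].
exact: (level_unique x).
Qed.

(** * Trees given by a parent map, and paths in them *)

Section ParentGraph.
Variables (V : finType) (root : V) (par : V -> V) (rank : V -> nat).
Hypothesis rank_par : forall x, x != root -> rank (par x) < rank x.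

Definition par_edge : rel V :=
  [rel x y | (x != root) && (par x == y) || (y != root) && (par y == x)].

Lemma par_edge_sym : symmetric par_edge.
Proof. by move=> x y; rewrite /par_edge /= orbC. Qed.

Lemma par_edge_irrefl : irreflexive par_edge.
Proof.
move=> x; rewrite /par_edge /= orbb; apply/negbTE/negP=> /andP[xr /eqP xx].
by have := rank_par xr; rewrite xx ltnn.
Qed.

Definition parent_graph : sgraph := SGraph par_edge_sym par_edge_irrefl.

Lemma parent_graph_connected : connected (whole parent_graph).
Proof.
split; first by apply/set0Pn; exists root; rewrite inE.
have to_root x : connect par_edge x root.
  have [n] := ubnP (rank x); elim: n x => // n IHn x le_xn.
  have [->|xr] := eqVneq x root; first exact: connect0.
  apply: (connect_trans (y := par x)); first by apply: connect1; rewrite /par_edge /= xr eqxx.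
  by apply: IHn; apply: leq_trans (rank_par xr) _.
move=> x y _ _; apply: connect_trans (to_root x) _.
by rewrite (sym_connect_sym par_edge_sym).
Qed.

(* A vertex of largest rank on a cycle has its parent as only neighbour. *)
Lemma parent_graph_acyclic : acyclic (whole parent_graph).
Proof.
move=> [//|x0 c0] /andP[]; set c := x0 :: c0 => c_cyc c_uniq.
rewrite ltnNge; apply/negP=> c_size.
have x0c : x0 \in c by rewrite mem_head.
have [x xc x_max] := arg_maxnP rank (P := mem c) x0c.
have up y : y \in c -> par_edge x y -> y = par x.
  move=> yc /orP[/andP[_ /eqP-> //]|/andP[yr /eqP yx]].
  by have := leq_trans (rank_par yr) (x_max y yc); rewrite yx ltnn.
have [i p def_p] := rot_to xc.
have mem_p y : y \in p -> y \in c by rewrite -(mem_rot i c) def_p inE orbC => ->.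
move: c_cyc c_uniq c_size.
rewrite -(rot_cycle i) -(rot_uniq i) -(size_rot i) def_p.
case: p mem_p {def_p} => [|y [|z q]] // mem_p; rewrite /= rcons_path.
case/and4P=> xy _ _ lx /and3P[_ /negP ynq _] _; apply: ynq.
(* Both cycle neighbours of [x] are its parent, so the second and the last vertex of the rotated
   cycle would coincide. *)
suff -> : y = last z q by apply: mem_last.
rewrite (up y) //; last by apply: mem_p; rewrite mem_head.
rewrite (up (last z q)) //; first by apply: mem_p; rewrite inE mem_last orbT.
by rewrite par_edge_sym.
Qed.

Lemma parent_graph_degree (x : V) :
  degree (whole parent_graph) x <= #|[set y | (y != root) && (par y == x)]|.+1.
Proof.
apply: leq_trans (_ : #|par x |: [set y | (y != root) && (par y == x)]| <= _).
  apply/subset_leq_card/subsetP=> y; rewrite !inE /= /par_edge /=.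
  by case/orP=> [/andP[_ /eqP->]|->]; rewrite ?eqxx ?orbT.
by apply: leq_trans (leq_card_setU _ _) _; rewrite cards1.
Qed.

End ParentGraph.

(** * Paths as subgraphs *)

Section SeqSubgraph.
Variables (T : sgraph) (s : seq T).
Hypothesis s_edge : sorted (@edge T) s.
Hypothesis s_uniq : uniq s.

Definition seq_edge : rel T :=
  [rel x y | [&& x \in s, y \in s &
     (index y s == (index x s).+1) || (index x s == (index y s).+1)]].

Lemma seq_edge_sym : symmetric seq_edge.
Proof. by move=> x y; rewrite /seq_edge /= andbCA orbC. Qed.

Lemma seq_edge_nth (x0 : T) (i : nat) :
  i.+1 < size s -> seq_edge (nth x0 s i) (nth x0 s i.+1).
Proof.
move=> lt_is; have lt_i := ltnW lt_is.
by rewrite /seq_edge /= !mem_nth // !index_uniq // eqxx.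
Qed.

Lemma seq_edge_sub (x y : T) :
  seq_edge x y -> [&& edge x y, x \in [set z in s] & y \in [set z in s]].
Proof.
have step u v : u \in s -> v \in s -> index v s = (index u s).+1 -> edge u v.
  move=> us vs iv; rewrite -(nth_index u us) -(nth_index u vs) iv.
  by move/(sortedP u): s_edge; apply; rewrite -iv index_mem.
case/and3P=> xs ys; rewrite !inE xs ys !andbT => /orP[]/eqP; first exact: step.
by rewrite edge_sym; apply: step.
Qed.

Definition seq_subgraph : subgraph T := Subgraph seq_edge_sym seq_edge_sub.

Lemma seq_subgraph_connected : s != [::] -> connected seq_subgraph.
Proof.
case def_s: s => [//|x0 s0] _; split.
  by apply/set0Pn; exists x0; rewrite inE def_s mem_head.
have reach x : x \in s -> connect seq_edge x0 x.
  move=> xs; rewrite -(nth_index x0 xs).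
  have: index x s < size s by rewrite index_mem.
  elim: (index x s) => [|i IHi] lt_i; first by rewrite def_s.
  exact: connect_trans (IHi (ltnW lt_i)) (connect1 (seq_edge_nth x0 lt_i)).
move=> x y; rewrite !inE => xs ys; apply: connect_trans (reach y ys).
by rewrite (sym_connect_sym seq_edge_sym) reach.
Qed.

Lemma seq_subgraph_degree : max_degree_le seq_subgraph 2.
Proof.
move=> x _; rewrite /degree /=.
(* At either end of [s] the missing neighbour is replaced by [x] itself, which is harmless for an
   upper bound. *)
apply: leq_trans (_ : #|[set nth x s (index x s).-1; nth x s (index x s).+1]| <= _).
  apply/subset_leq_card/subsetP=> y; rewrite !inE => /and3P[_ ys].
  case/orP=> /eqP E; first by rewrite -E nth_index ?eqxx ?orbT.
  by rewrite E /= nth_index ?eqxx.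
by rewrite cards2; case: eqP.
Qed.

Lemma seq_subgraph_leaf (x0 z : T) :
  leaf seq_subgraph z -> z = head x0 s \/ z = last x0 s.
Proof.
case=> /=; rewrite inE => zs deg_z.
have iz : index z s < size s by rewrite index_mem.
have zE := nth_index x0 zs.
case def_i: (index z s) iz zE => [|i] iz zE; first by left; rewrite -nth0.
right; rewrite -nth_last.
have [->|ne] := eqVneq (size s).-1 i.+1; first by [].
have lt_i : i.+2 < size s by lia.
have := deg_z; rewrite /degree => /eqP/cards1P[w def_w].
have zi : nth x0 s i \in [set w].
  by rewrite -def_w inE /= seq_edge_sym -zE seq_edge_nth.
have zi2 : nth x0 s i.+2 \in [set w].
  by rewrite -def_w inE /= -zE seq_edge_nth.
move: zi zi2; rewrite !inE => /eqP Ei /eqP Ei2.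
have : nth x0 s i == nth x0 s i.+2 by rewrite Ei Ei2.
by rewrite (nth_uniq x0 (ltn_trans (ltnSn i) iz) lt_i s_uniq) => /eqP; lia.
Qed.

End SeqSubgraph.

Lemma acyclic_subgraph (T : sgraph) (K : subgraph T) :
  acyclic (whole T) -> acyclic K.
Proof.
move=> acT c /andP[c_cyc c_uniq]; apply: acT; rewrite /ucycle c_uniq andbT.
by apply: sub_cycle c_cyc => x y; apply: sedge_edge.
Qed.

Lemma connect_path_subgraph (T : sgraph) (P : pred T) (x y : T) :
  acyclic (whole T) -> x != y ->
  connect [rel a b | [&& edge a b, P a & P b]] x y ->
  exists K : subgraph T,
    [/\ is_tree K /\ max_degree_le K 2, forall z, leaf K z -> z = x \/ z = y,
        x \in sverts K /\ y \in sverts K & {in sverts K, forall z, P z}].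
Proof.
move=> acT xy /connectP[p0 p0_path].
case/shortenP: p0_path => p p_path p_uniq _ last_p.
have s_edge : sorted (@edge T) (x :: p) by apply: sub_path p_path => u v /andP[].
exists (seq_subgraph s_edge); split.
- split; last exact: seq_subgraph_degree.
  by split; [apply: seq_subgraph_connected | apply: acyclic_subgraph].
- by move=> z /(seq_subgraph_leaf p_uniq x); rewrite /= -last_p.
- by rewrite /= !inE eqxx last_p -in_cons mem_last.
move=> z; rewrite !inE => zp.
(* The relation tests [P] only at the ends of edges, so [P x] needs a first edge, which exists
   because [x] and [y] differ. *)
case: p {p_uniq s_edge} p_path zp last_p => [_ _ E|w p]; first by rewrite E eqxx in xy.
move=> p_path + _ => /predU1P[->|]; first by case/andP: p_path => /and3P[].
elim: p x w p_path {xy} => [|v p IHp] u w /= /andP[/and3P[_ Pu Pw] p_path].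
  by rewrite inE => /eqP->.
by rewrite inE => /predU1P[-> //|]; apply: (IHp w).
Qed.

(** * The representing tree *)

(* The tree has four nodes per vertex [v] of [H]: a leaf attached to a top
   node; a spine node, the spine nodes of the children of [v] forming a path
   that hangs from the top node of [v]; and a hub between the spine node of [v]
   and the top nodes of the vertices represented by [v].  The subtree of an edge
   joins the leaves of its two ends. *)
Section LayeringTree.
Variables (H : sgraph) (r : H) (d : H -> nat) (pi rep : H -> H).
Hypothesis lay : layering r d pi rep.

Local Notation V := (H * (bool * bool))%type.
Definition leaf_node (v : H) : V := (v, (true, true)).
Definition top_node (v : H) : V := (v, (true, false)).
Definition hub_node (v : H) : V := (v, (false, true)).
Definition spine_node (v : H) : V := (v, (false, false)).

Definition children (v : H) : seq H := [seq c <- enum H | (c != r) && (pi c == v)].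
Definition child_index (c : H) : nat := index c (children (pi c)).

Definition spine_parent (c : H) : V :=
  if child_index c is j.+1 then spine_node (nth c (children (pi c)) j)
  else top_node (pi c).

Definition node_parent (x : V) : V :=
  match x with
  | (v, (true, true)) => top_node v
  | (v, (true, false)) => hub_node (rep v)
  | (v, (false, true)) => spine_node v
  | (v, (false, false)) => spine_parent v
  end.

(** The depth is the leading digit in base [#|H|.+4]. Within a depth the spine nodes come first,
    ordered by child index, then hubs, top nodes and leaves. *)
Definition node_rank (x : V) : nat :=
  d x.1 * #|H|.+4 +
  match x.2 with
  | (true, true) => #|H|.+3
  | (true, false) => #|H|.+2
  | (false, true) => #|H|.+1
  | (false, false) => child_index x.1
  end.

Lemma mem_children (v c : H) : (c \in children v) = (c != r) && (pi c == v).
Proof. by rewrite mem_filter mem_enum andbT. Qed.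

Lemma children_uniq (v : H) : uniq (children v).
Proof. exact/filter_uniq/enum_uniq. Qed.

Lemma child_index_le (c : H) : child_index c <= #|H|.
Proof.
by apply: leq_trans (index_size _ _) _; rewrite cardE size_filter count_size.
Qed.

Lemma child_index_inj (c c' : H) :
  c != r -> c' != r -> pi c = pi c' -> child_index c = child_index c' -> c = c'.
Proof.
move=> cr cr' Epi Ei.
rewrite -(nth_index c (_ : c \in children (pi c))) ?mem_children ?cr ?eqxx //.
rewrite -/(child_index c) Ei /child_index Epi nth_index //.
by rewrite mem_children cr' eqxx.
Qed.

Variant spine_parent_spec (c : H) : V -> Prop :=
  | SpinePrevious b of b != r & pi b = pi c & child_index c = (child_index b).+1 :
      spine_parent_spec c (spine_node b)
  | SpineTop of child_index c = 0 : spine_parent_spec c (top_node (pi c)).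

Lemma spine_parentP (c : H) : c != r -> spine_parent_spec c (spine_parent c).
Proof.
move=> cr; rewrite /spine_parent.
case def_i: (child_index c) => [|j]; first by constructor.
have lt_j : j < size (children (pi c)).
  by apply: ltnW; rewrite -def_i index_mem mem_children cr eqxx.
have := mem_nth c lt_j; rewrite mem_children => /andP[br /eqP pib].
by constructor; rewrite // def_i /child_index pib index_uniq ?children_uniq.
Qed.

(** This gives every node at most one spine node as a child, for the degree bound. *)
Lemma spine_parent_inj (c c' : H) :
  c != r -> c' != r -> spine_parent c = spine_parent c' -> c = c'.
Proof.
move=> cr cr'; case: (spine_parentP cr) => [b br pib ib|ic];
  case: (spine_parentP cr') => [b' br' pib' ib'|ic'] // [E].
- by apply: child_index_inj; rewrite // -?pib -?pib' ?ib ?ib' E.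
- by apply: child_index_inj; rewrite // ic ic'.
Qed.

Lemma node_rank_parent (x : V) :
  x != spine_node r -> node_rank (node_parent x) < node_rank x.
Proof.
case: x => v [[] []]; rewrite /node_rank /= ?(lay_rep_depth lay); try lia.
  by rewrite ltn_add2l ltnS child_index_le.
rewrite xpair_eqE eqxx andbT => vr.
have dv := lay_depth lay vr.
case: (spine_parentP vr) => [b br pib ib|iv] /=.
  have := lay_depth lay br; rewrite pib -dv => ->; rewrite ib; lia.
by rewrite iv dv; lia.
Qed.

(** The root is the spine node of [r]. *)
Definition layering_tree : sgraph := parent_graph node_rank_parent.

Lemma children_leaf (v : H) :
  [set y | (y != spine_node r) && (node_parent y == leaf_node v)] = set0.
Proof.
apply/setP=> -[w [[] []]]; rewrite !inE //= !xpair_eqE ?andbF //.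
rewrite /= andbT; apply/negbTE/negP=> /andP[wr /eqP].
by case: (spine_parentP wr).
Qed.

(** Every node has at most two children: a leaf none, a top node its leaf and one spine node, a hub
    the top nodes of the at most two vertices it represents, and a spine node its hub and the next
    spine node. *)
Lemma layering_tree_degree : max_degree_le (whole layering_tree) 3.
Proof.
move=> x _; apply: leq_trans (parent_graph_degree node_rank_parent x) _.
rewrite ltnS.
pose spines := [set y | [&& y != spine_node r, node_parent y == x & y.2 == (false, false)]].
have spines1 : #|spines| <= 1.
  apply/card_le1_eqP=> -[v [[] []]] [w [[] []]]; rewrite !inE ?andbF //.
  rewrite !xpair_eqE !andbT /= => /andP[vr /eqP vx] /andP[wr /eqP wx].
  by rewrite (spine_parent_inj vr wr) // vx wx.
case: x @spines spines1 => v [[] []] spines spines1.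
- by rewrite (_ : [set y | _] = set0) ?cards0 //; apply: children_leaf.
- apply: leq_trans (_ : #|leaf_node v |: spines| <= _); last first.
    by apply: leq_trans (leq_card_setU _ _) _; rewrite cards1.
  apply/subset_leq_card/subsetP=> -[w [[] []]]; rewrite !inE !xpair_eqE ?andbF ?andbT //=.
  by move=> ->.
- apply: leq_trans (lay_rep_card lay v).
  apply: leq_trans (leq_imset_card top_node _).
  apply/subset_leq_card/subsetP=> -[w [[] []]]; rewrite !inE !xpair_eqE ?andbF ?andbT //=.
    by move=> /eqP wv; apply/imsetP; exists w; rewrite // inE wv.
  by case/andP=> wr /eqP; case: (spine_parentP wr).
apply: leq_trans (_ : #|hub_node v |: spines| <= _); last first.
  by apply: leq_trans (leq_card_setU _ _) _; rewrite cards1.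
apply/subset_leq_card/subsetP=> -[w [[] []]]; rewrite !inE !xpair_eqE ?andbF ?andbT //=.
by move=> ->.
Qed.

Lemma leaf_node_edge (v : H) (y : layering_tree) :
  edge (leaf_node v : layering_tree) y = (y == top_node v).
Proof.
have := in_set0 y; rewrite -(children_leaf v) inE /= /par_edge /= => ->.
by rewrite orbF [RHS]eq_sym xpair_eqE andbF.
Qed.

Lemma leaf_node_leaf (v : H) : leaf (whole layering_tree) (leaf_node v).
Proof.
split; first by rewrite inE.
rewrite /degree /= -(cards1 (top_node v)); congr #|pred_of_set _|.
by apply/setP=> y; rewrite !inE -leaf_node_edge.
Qed.

(* The nodes that may occur on the path representing the edge [e]. *)
Definition owned (e : {set H}) (x : V) : bool :=
  match x with
  | (v, (true, _)) => v \in e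
  | (v, (false, true)) => e \subset pi v |: [set y | rep y == v]
  | (v, (false, false)) => (v != r) && (pi v \in e)
  end.

Definition owned_edge (e : {set H}) : rel layering_tree :=
  [rel x y : layering_tree | [&& edge x y, owned e x & owned e y]].

Lemma owned_edge_sym (e : {set H}) : symmetric (owned_edge e).
Proof.
by move=> x y; rewrite /owned_edge /= par_edge_sym [owned e x && _]andbC.
Qed.

Lemma owned_parent (e : {set H}) (x : V) :
  (x.2 == (false, false) -> x.1 != r) -> owned e x ->
  owned e (node_parent x) -> connect (owned_edge e) x (node_parent x).
Proof.
move=> x_root ex epx; have xr : x != spine_node r.
  by apply/eqP=> x_r; move: x_root; rewrite x_r !eqxx => /(_ isT).
 apply: connect1; rewrite /owned_edge /= /par_edge /=.
by rewrite xr eqxx ex epx.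
Qed.

(** The climb passes the spine nodes of earlier siblings, which [e] owns because they have the same
    parent in [H]. *)
Lemma owned_spine (e : {set H}) (c : H) :
  c != r -> pi c \in e -> connect (owned_edge e) (spine_node c) (top_node (pi c)).
Proof.
have [n] := ubnP (child_index c); elim: n c => // n IHn c le_cn cr ce.
have ownc : owned e (spine_node c) by rewrite /= cr.
have := @owned_parent e (spine_node c) (fun=> cr) ownc; rewrite /=.
case: (spine_parentP cr) => [b br pib ib|_] step; last exact: step.
have be : pi b \in e by rewrite pib.
apply: connect_trans (step _) _; first by rewrite /= br.
by rewrite -pib; apply: IHn => //; move: le_cn; rewrite ib.
Qed.

Lemma owned_hub (e : {set H}) (v : H) :
  v \in e -> e \subset pi v |: [set y | rep y == rep v] ->
  connect (owned_edge e) (leaf_node v) (hub_node (rep v)).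
Proof.
move=> ve sub_e; apply: (connect_trans (y := top_node v)).
  exact: (@owned_parent e (leaf_node v)).
by apply: (@owned_parent e (top_node v)); rewrite //= (lay_rep_pi lay).
Qed.

(** For an edge from a child to its parent, the route climbs from the leaf of the child through the
    hub of its representative and along the spine to the top node of the parent. For an edge between
    siblings, the two leaves meet at their common hub. *)
Lemma owned_connect (u v : H) :
  edge u v -> connect (owned_edge [set u; v]) (leaf_node u) (leaf_node v).
Proof.
have csym e := sym_connect_sym (@owned_edge_sym e).
have tree_edge w : w != r -> connect (owned_edge [set pi w; w]) (leaf_node w) (leaf_node (pi w)).
  move=> wr; set e := [set pi w; w].
  have we : w \in e by rewrite !inE eqxx orbT.
  have pe : pi w \in e by rewrite !inE eqxx.
  have sub_e : e \subset pi w |: [set y | rep y == rep w].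
    by apply/subsetP=> y; rewrite !inE => /orP[]/eqP->; rewrite eqxx ?orbT.
  have rr : rep w != r by rewrite (lay_rep_root lay).
  apply: connect_trans (owned_hub we sub_e) _.
  apply: (connect_trans (y := spine_node (rep w))).
    by apply: (@owned_parent e (hub_node (rep w))); rewrite //= (lay_rep_pi lay) // rr.
  apply: (connect_trans (y := top_node (pi w))).
    by rewrite -(lay_rep_pi lay); apply: owned_spine; rewrite ?(lay_rep_pi lay).
  by rewrite csym; apply: (@owned_parent e (leaf_node (pi w))).
case/(lay_edge lay)=> [[vr ->]|[ur ->]|[ur vr Epi Erep]].
- by rewrite csym; apply: tree_edge.
- by rewrite setUC; apply: tree_edge.
have sub w : pi w = pi u -> rep w = rep u ->
    [set u; v] \subset pi w |: [set y | rep y == rep w].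
  move=> -> ->; apply/subsetP=> y; rewrite !inE.
  by case/orP=> /eqP->; rewrite ?Erep eqxx orbT.
apply: (connect_trans (y := hub_node (rep u))).
  by apply: owned_hub; [rewrite !inE eqxx | apply: sub].
rewrite csym Erep; apply: owned_hub; first by rewrite !inE eqxx orbT.
exact: sub.
Qed.

(** At a hub both edges lie in a set of at most three vertices, where two pairs always meet. Any
    other node determines a vertex contained in both edges. *)
Lemma owned_share (e f : {set H}) (x : V) :
  e \in edge_set H -> f \in edge_set H -> owned e x -> owned f x ->
  e :&: f != set0.
Proof.
move=> eE fE; case: x => v [[|] [|]] /=.
- by move=> ve vf; apply/set0Pn; exists v; rewrite inE ve.
- by move=> ve vf; apply/set0Pn; exists v; rewrite inE ve.
- move=> se sf; rewrite -card_gt0.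
  have card2 g : g \in edge_set H -> #|g| = 2.
    by case/edge_setP=> a [b [ab ->]]; rewrite cards2 (edge_neq ab).
  have le3 : #|e :|: f| <= 3.
    apply: leq_trans (_ : #|pi v |: [set y | rep y == v]| <= _).
      by apply: subset_leq_card; rewrite subUset se.
    apply: leq_trans (leq_card_setU _ _) _.
    by rewrite cards1 ltnS (lay_rep_card lay).
  by have := cardsUI e f; rewrite (card2 e) // (card2 f) //; lia.
by move=> /andP[_ ve] /andP[_ vf]; apply/set0Pn; exists (pi v); rewrite inE ve.
Qed.

Theorem ORTH_layering : ORTH 3 2 2 (line_graph H).
Proof.
have acT : acyclic (whole layering_tree) by exact: parent_graph_acyclic.
have /fin_all_exists[S S_def] (e : line_graph H) : exists K : subgraph layering_tree,
    [/\ is_tree K /\ max_degree_le K 2,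
        forall z, leaf K z -> leaf (whole layering_tree) z,
        {in val e, forall v, leaf_node v \in sverts K}
      & {in sverts K, forall z, owned (val e) z}].
  have /edge_setP[u [v [uv ->]]] := valP e.
  have neq : (leaf_node u : layering_tree) != leaf_node v.
    by rewrite xpair_eqE (negbTE (edge_neq uv)).
  have [K [Ktree Kleaf [uK vK] Kown]] := connect_path_subgraph acT neq (owned_connect uv).
  exists K; split=> // [z /Kleaf[]-> | w]; try exact: leaf_node_leaf.
  by rewrite !inE => /orP[]/eqP->.
(* The top node is the only neighbour of the leaf, so every path from this leaf contains it. It
   supplies the second common vertex of two paths that share a leaf. *)
have topS (e : line_graph H) v : v \in val e -> top_node v \in sverts (S e).
  move=> ve; have [[[Sconn _] _] _ eS _] := S_def e.
  have S_gt1 : 1 < #|sverts (S e)|.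
    have /edge_setP[a [b [ab e_ab]]] := valP e.
    apply: (card_ge2 (x := leaf_node a) (y := leaf_node b)).
    - by apply: eS; rewrite e_ab !inE eqxx.
    - by apply: eS; rewrite e_ab !inE eqxx orbT.
    by rewrite xpair_eqE (negbTE (edge_neq ab)).
  have [y vy] := connected_neighbor Sconn S_gt1 (eS v ve).
  have := sedge_edge vy; rewrite leaf_node_edge => /eqP <-.
  by case/sedge_mem: vy.
(* One common node already forces adjacency, which settles the converse for both the vertex count
   and the shared leaf. *)
have inter (e f : line_graph H) x :
    e <> f -> x \in sverts (S e) -> x \in sverts (S f) -> edge e f.
  move=> /eqP ef xe xf; rewrite /= /line_edge /= ef.
  have [_ _ _ ownE] := S_def e; have [_ _ _ ownF] := S_def f.
  exact: (owned_share (valP e) (valP f) (ownE x xe) (ownF x xf)).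
have shared (e f : line_graph H) : edge e f -> exists2 v, v \in val e & v \in val f.
  by case/andP=> _ /set0Pn[v]; rewrite inE => /andP[]; exists v.
exists layering_tree, S; split.
- by split; [split; first exact: parent_graph_connected | exact: layering_tree_degree].
- by move=> e; case: (S_def e).
- by move=> e x; case: (S_def e) => _ + _ _; apply.
move=> e f ef; split; split.
- case/shared=> v ve vf; apply: (card_ge2 (x := leaf_node v) (y := top_node v)).
  + by rewrite inE; have [_ _ -> // _] := S_def e; have [_ _ -> // _] := S_def f.
  + by rewrite inE !topS.
  by rewrite xpair_eqE andbF.
- by case/ltnW/card_gt0P=> x; rewrite inE => /andP[]; apply: inter.
- case/shared=> v ve vf; exists (leaf_node v); split; first exact: leaf_node_leaf.
    by have [_ _ -> //] := S_def e.
  by have [_ _ -> //] := S_def f.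
by case=> x [_ xe xf]; apply: inter xe xf.
Qed.

End LayeringTree.

Theorem theorem5 (G H : sgraph) :
  connected (whole G) -> twin_free G -> 4 <= #|G| ->
  connected (whole H) -> isomorphic (line_graph H) G ->
  (ORTH 3 2 2 G <->
  (forall B : subgraph H, block B -> #|sverts B| <= 3)).
Proof.
move=> _ _ _ Hconn isoHG; split=> [orthG B [nsB _] | block_le].
  apply: contraT; rewrite -ltnNge => /(nonseparable_long_cycle nsB).
  case=> a [b [c [d LC]]].
  have orthL := ORTH_isomorphic (isomorphic_sym isoHG) orthG.
  by have := ORTH_no_long_cycle a b c d orthL; rewrite LC.
apply: ORTH_isomorphic isoHG _.
have /set0Pn[r _] := Hconn.1.
have [a b c d|d [pi [rep lay]]] := no_long_cycle_layering r Hconn.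
  exact: blocks_no_long_cycle.
exact: ORTH_layering lay.
Qed.
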